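(* Let $\kappa\ge2$, $n\ge1$, $0\le u\le\kappa-1$ be integers and $0<\epsilon<1$. Define $\check q^{\{u\}}\in\mathbb{R}^{2^\kappa}$ by $\check q^{\{u\}}_i=0$ for $0\le i<2^u$ and $\check q^{\{u\}}_i=\frac{1}{2^\kappa-2^u}$ for $2^u\le i\le2^\kappa-1$. For each $(\kappa-1)$-dimensional subspace $S$ of $W$, define $\check q^{[S]}$ by $\check q^{[S]}_i=0$ if $\nu(i)\in S$ and $\check q^{[S]}_i=2^{1-\kappa}$ otherwise. Let $\mathcal{C}_u$ be the set of $q\in\mathbb{R}^{2^\kappa}$ such that: $q_0=0$; $q_i\ge0$ for all $i$; $\sum_iq_i=1$; $\|q-\bar q\|=\sqrt{\frac{2^u-1}{(2^\kappa-2^u)(2^\kappa-1)}}$ where $\bar q_0=0$, $\bar q_i=\frac{1}{2^\kappa-1}$ for $i\ge1$; and $\|q-\check q^{[S]}\|\ge\|\check q^{\{u\}}-\check q^{\{\kappa-1\}}\|$ for every $S\in\Xi(W,\kappa-1)$. Then $\check q^{\{u\}}\in\mathcal{C}_u$ and $\lambda(n,\epsilon,\check q^{\{u\}})\le\lambda(n,\epsilon,q)$ for all $q\in\mathcal{C}_u$.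
   Context: $W=\mathbb{F}_2^\kappa$; $\nu(i)\in W$ is the binary expansion of $i\in\{0,\dots,2^\kappa-1\}$ (so $\{\nu(i):i<2^u\}$ is a $u$-dimensional subspace); vectors $q$ are indexed $q_0,\dots,q_{2^\kappa-1}$, and $\|\cdot\|$ is the Euclidean norm (all vectors here have $0$-th coordinate $0$). For a subspace $S\subseteq W$, $\zeta(S,q)=\sum_{i:\nu(i)\in S}q_i$; $\Xi(W,\kappa-1)$ is the set of $(\kappa-1)$-dimensional subspaces of $W$. For real $q$ define $\lambda(n,\epsilon,q)=(2-\epsilon)^n2^{-\kappa}\Big(1+\sum_{S\in\Xi(W,\kappa-1)}\big(\tfrac{\epsilon}{2-\epsilon}\big)^{n(1-\zeta(S,q))}\Big)-1$ (the $\chi^2$ divergence between $p_{MZ}$ and $p_Mp_Z$ for the coset code over a binary erasure channel with erasure probability $\epsilon$, when $q$ is a generator matrix's column-distribution vector). $\check q^{\{u\}}$ is the subspace exclusion code excluding a $u$-dimensional subspace. *)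

(* Defs.v *)
From HB Require Import structures.
From mathcomp Require Import all_boot all_order all_algebra.
From mathcomp Require Import boolp reals exp.
Set Implicit Arguments. Unset Strict Implicit. Unset Printing Implicit Defensive.
Import Order.TTheory GRing.Theory Num.Theory.
Local Open Scope ring_scope.

Notation W k := 'rV['F_2]_k.

Definition nu (k : nat) (i : 'I_(2 ^ k)) : W k :=
  \row_(j < k) ((((i : nat) %/ 2 ^ j) %% 2)%N)%:R.

Definition is_hyp (k : nat) (S : {set W k}) : Prop :=
  exists U : {vspace W k}, (\dim U = k.-1)%N /\ S = [set v | v \in U].

Definition Xi (k : nat) : {set {set W k}} := [set S | `[< is_hyp S >]].

Section Defs.
Variable R : realType.

Definition zeta (k : nat) (S : {set W k}) (q : 'I_(2 ^ k) -> R) : R :=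
  \sum_(i | nu i \in S) q i.

Definition lambda (k n : nat) (eps : R) (q : 'I_(2 ^ k) -> R) : R :=
  (2 - eps) ^+ n * (2 ^+ k)^-1 *
  (1 + \sum_(S in Xi k) powR (eps / (2 - eps)) (n%:R * (1 - zeta S q))) - 1.

Definition dist (k : nat) (p q : 'I_(2 ^ k) -> R) : R :=
  Num.sqrt (\sum_i (p i - q i) ^+ 2).

(* subspace exclusion code excluding the u-dim subspace {nu i : i < 2^u} *)
Definition qcheck (k u : nat) (i : 'I_(2 ^ k)) : R :=
  if ((i : nat) < 2 ^ u)%N then 0 else (2 ^+ k - 2 ^+ u)^-1.

Definition qhyp (k : nat) (S : {set W k}) (i : 'I_(2 ^ k)) : R :=
  if nu i \in S then 0 else (2 ^+ k.-1)^-1.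

Definition qbar (k : nat) (i : 'I_(2 ^ k)) : R :=
  if (i : nat) == 0%N then 0 else (2 ^+ k - 1)^-1.

Definition Cu (k u : nat) (q : 'I_(2 ^ k) -> R) : Prop :=
  [/\ forall i : 'I_(2 ^ k), (i : nat) = 0%N -> q i = 0,
      forall i, 0 <= q i,
      \sum_i q i = 1,
      dist q (@qbar k) =
        Num.sqrt ((2 ^+ u - 1) / ((2 ^+ k - 2 ^+ u) * (2 ^+ k - 1)))
    & forall S, S \in Xi k ->
        dist (@qcheck k u) (@qcheck k k.-1) <= dist q (qhyp S)].
End Defs.

(* Main.v *)
Require Import Defs.
From HB Require Import structures.
From mathcomp Require Import all_boot all_order all_algebra.
From mathcomp Require Import boolp reals exp.
From mathcomp Require Import topology normedtype sequences derive realfun.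
From mathcomp Require Import zify ring lra.
Import Order.TTheory GRing.Theory Num.Theory.
Import numFieldNormedType.Exports.
Local Open Scope ring_scope.
Set Implicit Arguments.
Unset Strict Implicit.
Unset Printing Implicit Defensive.

(** Hyperplanes of [W] are the orthogonals of the nonzero vectors [a], and
    [zeta (perp a) q = (1 + walsh q a) / 2] where [walsh q] is the Walsh transform
    of [q].  With [D = 2 ^ k - 2 ^ u], membership of [q] in [Cu] fixes
    [\sum_(a != 0) walsh q a] and (by Parseval) [\sum_(a != 0) walsh q a ^ 2], and
    the distances to the codes [qhyp S] say exactly that
    [walsh q a >= y0 := - 2 ^ u / D].  Up to increasing affine maps, [lambda] is
    [\sum_(a != 0) exp (s * walsh q a)] with [s > 0].  The parabola that meets
    [exp (s * y)] at [y0] and is tangent to it at [0] lies below it on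
    [y >= y0]; its sum over [a] is the same for all [q] in [Cu], and there is
    equality throughout for [qcheck], whose Walsh transform only takes the values
    [y0] and [0]. *)

(** * Calculus: the exponential against parabolas *)

Lemma is_derive_ge0_homo (R : realType) (f df : R -> R) (a b : R) :
  (forall x, a <= x <= b -> is_derive x 1 f (df x)) ->
  (forall x, a <= x <= b -> 0 <= df x) -> a <= b -> f a <= f b.
Proof.
move=> fdf df0 ab.
apply: (@ger0_derive1_ndecr _ f a b) => // [x|x|].
- by rewrite in_itv /= => /andP[/ltW ax /ltW xb]; have [] := fdf x; rewrite ?ax.
- rewrite in_itv /= => /andP[/ltW ax /ltW xb].
  by rewrite derive1E; have [|_ ->] := fdf x; rewrite ?ax ?df0 ?ax.
- apply: derivable_within_continuous => x; rewrite in_itv /= => axb.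
  by have [] := fdf x axb.
Qed.

(** The derivative is [expR z - 1 - z], which is nonnegative. Comparison with the value at 0 gives
    second-order Taylor bounds on both sides of 0. *)
Lemma expR_second_order_homo (R : realType) (x y : R) : x <= y ->
  expR x - 1 - x - x ^+ 2 / 2 <= expR y - 1 - y - y ^+ 2 / 2.
Proof.
move=> xy.
pose f (z : R) := expR z - 1 - z - z ^+ 2 / 2.
apply: (@is_derive_ge0_homo _ f (fun z => expR z - 1 - z)) => // z _.
  by apply: is_derive_eq; rewrite /GRing.scale /=; field.
have := expR_ge1Dx z; lra.
Qed.

(** This is the numerator of the derivative in [expR_quotient_homo]. It vanishes at 0 and is
    nondecreasing. *)
Lemma expR_pade_le0 (R : realType) (z : R) : z <= 0 ->
  (z - 2) * expR z + z + 2 <= 0.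
Proof.
move=> z0; pose f (z : R) := (z - 2) * expR z + z + 2.
have -> : 0 = f 0 by rewrite /f expR0; lra.
apply: (@is_derive_ge0_homo _ f (fun z => (z - 1) * expR z + 1)) => // w _.
  by apply: is_derive_eq; rewrite /GRing.scale /=; ring.
(* Multiplying [1 - w <= expR (- w)] by [expR w] gives [(1 - w) * expR w <= 1]. *)
have := expR_ge1Dx (- w); have := expR_gt0 w; have := expRxMexpNx_1 w; nra.
Qed.

Lemma expR_quotient_homo (R : realType) (x y : R) : x <= y -> y < 0 ->
  (expR x - 1 - x) / x ^+ 2 <= (expR y - 1 - y) / y ^+ 2.
Proof.
move=> xy y0; pose f (z : R) := (expR z - 1 - z) / z ^+ 2.
apply: (@is_derive_ge0_homo _ f
  (fun z => ((z - 2) * expR z + z + 2) / z ^+ 3)) => // z /andP[_ zy].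
  have z0 : z != 0 by lra.
  have z20 : z ^+ 2 != 0 by rewrite expf_neq0.
  have dV := @is_deriveV _ (fun z => z ^+ 2) z _ 1 z20 (is_deriveX 1 _).
  by apply: is_derive_eq; rewrite /GRing.scale /=; field.
have z0 : z < 0 by lra.
rewrite mulr_le0 ?expR_pade_le0 ?ltW // invr_lt0 exprS pmulr_llt0 //.
by rewrite expr2 nmulr_rgt0.
Qed.

(* The parabola interpolates the exponential at [z0] and doubly at [0]; it stays
   below because [(exp z - 1 - z) / z ^ 2] is increasing. *)
Lemma expR_ge_parabola (R : realType) (z0 z : R) : z0 < 0 -> z0 <= z ->
  1 + z + (expR z0 - 1 - z0) / z0 ^+ 2 * z ^+ 2 <= expR z.
Proof.
move=> z00 z0z; set b := _ / _.
have pos (x : R) : x != 0 -> 0 < x ^+ 2 by move=> x0; rewrite exprn_even_gt0.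
have [zN|zP|->] := ltgtP z 0; last by rewrite expR0; lra.
- have := expR_quotient_homo z0z zN; rewrite -/b ler_pdivlMr ?pos ?lt_eqF //.
  by lra.
(* For positive [z] the comparison passes through 1/2, the limit of the quotient at 0. *)
- have bh : b <= 2^-1.
    rewrite ler_pdivrMr ?pos ?lt_eqF //.
    by have := expR_second_order_homo (ltW z00); rewrite expR0; lra.
  have := expR_second_order_homo (ltW zP); rewrite expR0.
  have : 0 < z ^+ 2 by rewrite exprn_gt0.
  nra.
Qed.

(** * Binary expansions and the bijection [nu] *)

Lemma F2_eq0_inj (x y : 'F_2) : (x == 0) = (y == 0) -> x = y.
Proof. by case: x y => [[|[|x]] //= ?] [[|[|y]] //= ?] _; apply/val_inj. Qed.

Lemma natr_F2_inj (m n : nat) : (m%:R == n%:R :> 'F_2) = (m %% 2 == n %% 2)%N.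
Proof. by rewrite -val_eqE /= !val_Fp_nat. Qed.

(** Peeling off bit [j] allows residues modulo powers of 2 to be compared by induction on the number
    of bits. *)
Lemma modn_exp2S (m j : nat) :
  (m %% 2 ^ j.+1 = (m %/ 2 ^ j) %% 2 * 2 ^ j + m %% 2 ^ j)%N.
Proof.
rewrite modn_divl expnS {1}(divn_eq (m %% (2 * 2 ^ j)) (2 ^ j)).
by rewrite modn_dvdm // dvdn_mull.
Qed.

Lemma nu_bit (k : nat) (i i' : 'I_(2 ^ k)) (j : 'I_k) :
  nu i 0 j = nu i' 0 j <-> ((i %/ 2 ^ j) %% 2 = (i' %/ 2 ^ j) %% 2)%N.
Proof.
rewrite !mxE; split=> [/eqP|->//].
by rewrite natr_F2_inj !modn_mod => /eqP.
Qed.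

Lemma nu_inj (k : nat) : injective (@nu k).
Proof.
move=> i i' /rowP eq_nu; apply/val_inj => /=.
suff mod_eq j : (j <= k)%N -> (i %% 2 ^ j = i' %% 2 ^ j)%N.
  by have := mod_eq k (leqnn k); rewrite !modn_small.
elim: j => [|j IH] jk; first by rewrite !modn1.
rewrite (modn_exp2S i j) (modn_exp2S i' j) (IH (ltnW jk)).
by have /nu_bit /= -> := eq_nu (Ordinal jk).
Qed.

Lemma nu_bij (k : nat) : bijective (@nu k).
Proof. by apply: inj_card_bij (@nu_inj k) _; rewrite card_mx card_Fp // card_ord mul1n. Qed.

Lemma nu_eq0 (k : nat) (i : 'I_(2 ^ k)) : (nu i == 0) = ((i : nat) == 0%N).
Proof.
apply/eqP/eqP => [ni0|i0]; last by apply/rowP => j; rewrite !mxE i0 div0n mod0n.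
have k0 : (0 < 2 ^ k)%N by rewrite expn_gt0.
suff -> : i = Ordinal k0 by [].
by apply: nu_inj; rewrite ni0; apply/rowP => j; rewrite !mxE div0n mod0n.
Qed.

(** Turns an order condition on indices into linear equations on coordinates, so that the excluded
    set is seen to be a subspace. *)
Lemma nu_lt_exp (k u : nat) (i : 'I_(2 ^ k)) : (u <= k)%N ->
  (i < 2 ^ u)%N = [forall j : 'I_k, (u <= j)%N ==> (nu i 0 j == 0)].
Proof.
move=> uk; apply/idP/forallP => [iu j|high0].
  apply/implyP => uj; rewrite !mxE divn_small ?mod0n //.
  by rewrite (leq_trans iu) // leq_exp2l.
suff mod_eq d : (u + d <= k)%N -> (i %% 2 ^ (u + d) = i %% 2 ^ u)%N.
  have := mod_eq (k - u)%N; rewrite subnKC // => /(_ (leqnn k)).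
  by rewrite modn_small // => ->; rewrite ltn_mod expn_gt0.
elim: d => [|d IH] udk; first by rewrite addn0.
rewrite addnS in udk; rewrite addnS (modn_exp2S i) IH 1?ltnW //.
have /= := high0 (Ordinal udk); rewrite leq_addr !mxE /=.
by rewrite -[0]/(0%:R) natr_F2_inj modn_mod => /eqP ->.
Qed.

(** * Hyperplanes as orthogonals of nonzero vectors *)

Definition dot (k : nat) (a v : W k) : 'F_2 := \sum_j a 0 j * v 0 j.

Lemma dotC (k : nat) (a v : W k) : dot a v = dot v a.
Proof. by apply: eq_bigr => j _; rewrite mulrC. Qed.

Lemma dotDr (k : nat) (a v w : W k) : dot a (v + w) = dot a v + dot a w.
Proof. by rewrite -big_split; apply: eq_bigr => j _; rewrite mxE mulrDr. Qed.

Lemma dotZr (k : nat) (a v : W k) c : dot a (c *: v) = c * dot a v.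
Proof. by rewrite mulr_sumr; apply: eq_bigr => j _; rewrite mxE mulrCA. Qed.

Lemma dot_delta (k : nat) (a : W k) (j : 'I_k) : dot a (delta_mx 0 j) = a 0 j.
Proof.
rewrite /dot (bigD1 j) //= mxE !eqxx mulr1 big1 ?addr0 // => l lj.
by rewrite mxE (negPf lj) andbF mulr0.
Qed.

Definition perp (k : nat) (a : W k) : {set W k} := [set v | dot a v == 0].

(** Membership of the basis vectors tells which coordinates of [a] vanish, and over ['F_2] this
    determines [a]. *)
Lemma perp_inj (k : nat) : injective (@perp k).
Proof.
move=> a b /setP eq_perp; apply/rowP => j; rewrite -!dot_delta.
by apply: F2_eq0_inj; have := eq_perp (delta_mx 0 j); rewrite !inE.
Qed.

Lemma neq0_coord (k : nat) (a : W k) : a != 0 -> exists j, a 0 j != 0.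
Proof.
move=> a0; apply/existsP; apply: contraNT a0; rewrite negb_exists => /forallP h.
by apply/eqP/rowP => j; rewrite mxE; apply/eqP; have := h j; rewrite negbK.
Qed.

Lemma dot_linear (k : nat) (a : W k) : linear (dot a : W k -> ('F_2)^o).
Proof. by move=> c v w; rewrite dotDr dotZr. Qed.

HB.instance Definition _ (k : nat) (a : W k) :=
  GRing.isLinear.Build 'F_2 (W k) ('F_2)^o _ (dot a) (dot_linear a).

Definition perp_space (k : nat) (a : W k) : {vspace W k} :=
  lker (linfun (dot a : W k -> ('F_2)^o)).

Lemma mem_perp_space (k : nat) (a v : W k) :
  (v \in perp_space a) = (dot a v == 0).
Proof. by rewrite memv_ker lfunE. Qed.

(** Rank-nullity: a nonzero form has an image of dimension 1. *)
Lemma dim_perp_space (k : nat) (a : W k) : a != 0 ->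
  (\dim (perp_space a) = k.-1)%N.
Proof.
move=> /neq0_coord[j aj0].
pose f := linfun (dot a : W k -> ('F_2)^o).
have := limg_ker_dim f fullv; rewrite capfv dimvf dim_matrix mul1r => dimE.
have dim_img : (\dim (limg f) = 1)%N.
  apply/eqP; rewrite eqn_leq (leq_trans (dimvS (subvf _))) ?dimvf //=.
  rewrite lt0n dimv_eq0; apply: contra aj0 => /eqP f0.
  have := memv_img f (memvf (delta_mx 0 j)).
  by rewrite f0 memv0 lfunE /= dot_delta.
by move: dimE; rewrite dim_img addn1 => /(congr1 predn).
Qed.

Lemma hyp_perp (k : nat) (S : {set W k}) : (0 < k)%N -> is_hyp S ->
  exists2 a, a != 0 & S = perp a.
Proof.
move=> k0 [U [dimU ->]].
(* [g] kills [U] but not [w], so some coordinate of [g] is a nonzero linear form vanishing on [U];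
   the vector [a] below represents it. *)
pose g := (\1 - projv U)%VF.
have [w wU] : exists w, w \notin U.
  apply: contrapT => allU.
  have : (fullv <= U)%VS.
    by apply/subvP => v _; apply: contrapT => /negP vU; apply: allU; exists v.
  by move=> /dimvS; rewrite dimvf dim_matrix mul1r dimU; lia.
have gE v : g v = v - projv U v by rewrite add_lfunE id_lfunE opp_lfunE.
have [j gwj] : exists j, g w 0 j != 0.
  apply: neq0_coord; rewrite gE subr_eq0; apply: contra wU => /eqP ->.
  exact: memv_proj.
pose a : W k := \row_i g (delta_mx 0 i) 0 j.
have dota v : dot a v = g v 0 j.
  rewrite {2}[v]row_sum_delta linear_sum summxE; apply: eq_bigr => i _.
  by rewrite linearZ !mxE mulrC.
have a0 : a != 0.
  apply: contra gwj => /eqP a0; rewrite -dota a0 /dot big1 // => i _.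
  by rewrite mxE mul0r.
exists a => //.
have /eqP -> : U == perp_space a.
  rewrite eqEdim dim_perp_space // dimU leqnn andbT; apply/subvP => v vU.
  by rewrite mem_perp_space dota gE projv_id // subrr mxE.
by apply/setP => v; rewrite !inE mem_perp_space.
Qed.

Lemma Xi_perp (k : nat) : (0 < k)%N ->
  Xi k = @perp k @: [set a | a != 0].
Proof.
move=> k0; apply/setP => S; rewrite inE; apply/asboolP/imsetP.
  by case/(hyp_perp k0) => a a0 ->; exists a; rewrite ?inE.
case=> a; rewrite inE => a0 ->; exists (perp_space a); split.
  exact: dim_perp_space.
by apply/setP => v; rewrite !inE mem_perp_space.
Qed.

Lemma sum_Xi (k : nat) (R : realType) (F : {set W k} -> R) : (0 < k)%N ->
  \sum_(S in Xi k) F S = \sum_(a : W k | a != 0) F (perp a).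
Proof.
move=> k0; rewrite Xi_perp // big_imset /=; last by move=> ? ? _ _ /perp_inj.
by apply: eq_bigl => a; rewrite inE.
Qed.

(** * Characters and the Walsh transform *)

Section Walsh.
Variables (R : realType) (k : nat).
Implicit Types (a v w : W k) (q : 'I_(2 ^ k) -> R).

(** The additive character $(-1)^{a\cdot v}$, with values in [R]. *)
Definition chi a v : R := if dot a v == 0 then 1 else -1.

Lemma chiC a v : chi a v = chi v a.
Proof. by rewrite /chi dotC. Qed.

Lemma chiDr a v w : chi a (v + w) = chi a v * chi a w.
Proof.
rewrite /chi dotDr; move: (dot a v) (dot a w).
by case=> [[|[|x]] //= ?] [[|[|y]] //= ?]; rewrite ?mulr1 ?mul1r ?mulrNN ?mulr1.
Qed.

Lemma chi0 v : chi 0 v = 1.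
Proof. by rewrite /chi /dot big1 ?eqxx // => j _; rewrite mxE mul0r. Qed.

Lemma chi_delta a j : a 0 j != 0 -> chi a (delta_mx 0 j) = -1.
Proof. by rewrite /chi dot_delta => /negPf ->. Qed.

Lemma addrr_W v : v + v = 0.
Proof. by apply/rowP => j; rewrite !mxE addrr_pchar2 // pchar_Fp. Qed.

(** Translation by [w] permutes the range of summation and flips the sign of every term, so the sum
    equals its opposite. *)
Lemma sum_chi_eq0 a w (P : pred (W k)) : (forall v, P (v + w) = P v) ->
  chi a w = -1 -> \sum_(v | P v) chi a v = 0.
Proof.
move=> Pw aw; suff : \sum_(v | P v) chi a v = - \sum_(v | P v) chi a v by lra.
rewrite {1}(reindex_inj (addIr w)) /= (eq_bigl P) // -sumrN.
by apply: eq_bigr => v _; rewrite chiDr aw mulrN1.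
Qed.

Lemma sum_chi v : \sum_a chi a v = if v == 0 then 2 ^+ k else 0.
Proof.
under eq_bigr do rewrite chiC.
have [->|/neq0_coord[j vj]] := eqVneq v 0.
  under eq_bigr do rewrite chi0.
  by rewrite sumr_const card_mx card_Fp // mul1n natrX.
by rewrite (@sum_chi_eq0 _ (delta_mx 0 j)) // chi_delta.
Qed.

Definition walsh q a : R := \sum_i q i * chi a (nu i).

Lemma walsh0 q : walsh q 0 = \sum_i q i.
Proof. by apply: eq_bigr => i _; rewrite chi0 mulr1. Qed.

Lemma zeta_walsh q a : zeta (perp a) q = (\sum_i q i + walsh q a) / 2.
Proof.
rewrite /zeta /walsh -big_split /= mulr_suml big_mkcond; apply: eq_bigr => i _.
by rewrite inE /chi; case: ifP => _; field.
Qed.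

(** By orthogonality of characters only index 0 survives, and [q] vanishes there. *)
Lemma sum_walsh q : (forall i : 'I_(2 ^ k), (i : nat) = 0%N -> q i = 0) ->
  \sum_a walsh q a = 0.
Proof.
move=> q0; rewrite exchange_big big1 //= => i _; rewrite -mulr_sumr sum_chi nu_eq0.
by case: eqP => [/q0 ->|_]; rewrite ?mul0r ?mulr0.
Qed.

(** Parseval: expanding the square, the cross terms with [i != j] carry a nontrivial character and
    cancel. *)
Lemma sum_walsh_sqr q : \sum_a walsh q a ^+ 2 = 2 ^+ k * \sum_i q i ^+ 2.
Proof.
under eq_bigr do rewrite expr2 /walsh mulr_suml.
rewrite exchange_big mulr_sumr; apply: eq_bigr => i _ /=.
under eq_bigr do rewrite mulr_sumr.
rewrite exchange_big (bigD1 i) //= [X in _ + X]big1 => [|j ji].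
  under eq_bigr do rewrite mulrACA -chiDr.
  by rewrite -mulr_sumr sum_chi addrr_W eqxx addr0 mulrC expr2.
under eq_bigr do rewrite mulrACA -chiDr.
rewrite -mulr_sumr sum_chi; case: eqP => [/eqP|_]; last by rewrite mulr0.
rewrite addr_eq0; have /eqP := addrr_W (nu j); rewrite addr_eq0 => /eqP <-.
by move=> /eqP/nu_inj ij; rewrite ij eqxx in ji.
Qed.
End Walsh.

(** [qcheck], [qhyp] and [qbar] all have this shape, zero on a set and constant off it, so each
    distance reduces to this expansion. *)
Lemma sum_sqr_sub_indicator (R : realType) (I : finType) (q : I -> R)
    (P : pred I) (c : R) :
  \sum_i (q i - (if P i then 0 else c)) ^+ 2 =
  \sum_i q i ^+ 2 - 2 * c * (\sum_(i | ~~ P i) q i)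
    + c ^+ 2 * \sum_(i | ~~ P i) 1.
Proof.
rewrite !(big_mkcond (fun i => ~~ P i)) !mulr_sumr -sumrB -big_split /=.
by apply: eq_bigr => i _; case: (P i) => /=; ring.
Qed.

(** * The exclusion code and the constraints defining [Cu] *)

Section ExclusionCode.
Variables (R : realType) (k u : nat).
Hypothesis uk : (u < k)%N.
Implicit Types (a v w : W k) (q : 'I_(2 ^ k) -> R).

Let D : R := 2 ^+ k - 2 ^+ u.
Let H : R := 2 ^+ k.-1.

Let kE : 2 ^+ k = 2 * H.
Proof. by rewrite -exprS prednK // (leq_ltn_trans _ uk). Qed.

Let H_gt0 : 0 < H. Proof. exact: exprn_gt0. Qed.

Let U_ge1 : 1 <= 2 ^+ u :> R. Proof. by rewrite exprn_ege1 // ler1n. Qed.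

Let D_gt0 : 0 < D. Proof. by rewrite subr_gt0 ltr_eXn2l // ltr1n. Qed.

Lemma sum_lt_exp2 (j : nat) : (j <= k)%N ->
  \sum_(i < 2 ^ k | (i < 2 ^ j)%N) 1 = 2 ^+ j :> R.
Proof.
move=> jk; rewrite -(big_ord_widen _ (fun=> 1)) ?leq_exp2l //.
by rewrite sumr_const card_ord natrX.
Qed.

Lemma sum_ge_exp2 (j : nat) : (j <= k)%N ->
  \sum_(i < 2 ^ k | ~~ (i < 2 ^ j)%N) 1 = 2 ^+ k - 2 ^+ j :> R.
Proof.
move=> jk; have := sum_lt_exp2 (leqnn k); under eq_bigl do rewrite ltn_ord.
rewrite (bigID (fun i : 'I__ => (i < 2 ^ j)%N)) /= sum_lt_exp2 // => <-.
by rewrite addrAC subrr add0r.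
Qed.

Lemma sum_qcheck_ge (j : nat) : (u <= j <= k)%N ->
  \sum_(i < 2 ^ k | ~~ (i < 2 ^ j)%N) qcheck R u i = (2 ^+ k - 2 ^+ j) / D.
Proof.
move=> /andP[uj jk]; rewrite -(sum_ge_exp2 jk) mulr_suml; apply: eq_bigr => i ji.
rewrite /qcheck ifN ?mul1r //; apply: contra ji => /leq_trans; apply.
by rewrite leq_exp2l.
Qed.

Lemma sum_qcheck : \sum_i @qcheck R k u i = 1.
Proof.
rewrite (bigID (fun i : 'I__ => (i < 2 ^ u)%N)) /= big1.
  by rewrite sum_qcheck_ge ?leqnn ?(ltnW uk) // add0r divff // gt_eqF.
by move=> i iu; rewrite /qcheck iu.
Qed.

Lemma sum_qcheck_sqr : \sum_i @qcheck R k u i ^+ 2 = D^-1.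
Proof.
rewrite -[RHS]mulr1 -sum_qcheck mulr_sumr; apply: eq_bigr => i _.
by rewrite /qcheck; case: ifP => _; rewrite ?expr0n ?mulr0 // expr2.
Qed.

Lemma sum_chi_nu a : a != 0 -> \sum_i chi R a (nu i) = 0.
Proof.
move=> a0; have -> : \sum_i chi R a (nu i) = \sum_v chi R a v.
  by rewrite [RHS](reindex (@nu k)) //; exact/onW_bij/nu_bij.
by under eq_bigr do rewrite chiC; rewrite sum_chi (negPf a0).
Qed.

(** A character is either trivial on the subspace, giving its cardinality, or takes the value -1 at
    some [w] in it, and then [sum_chi_eq0] applies. *)
Lemma sum_chi_nu_lt a :
  \sum_(i < 2 ^ k | (i < 2 ^ u)%N) chi R a (nu i) \in [:: 0; 2 ^+ u].
Proof.
pose T v := [forall j : 'I_k, (u <= j)%N ==> (v 0 j == 0)].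
have [/forallP chi1|] := boolP [forall v, T v ==> (chi R a v == 1)].
  rewrite !inE; apply/orP; right; rewrite -(sum_lt_exp2 (ltnW uk)).
  apply/eqP/eq_bigr => i iu; apply/eqP; have := chi1 (nu i).
  by rewrite /T -nu_lt_exp ?iu // ltnW.
rewrite negb_forall => /existsP[w]; rewrite negb_imply => /andP[Tw chiw].
rewrite !inE; apply/orP; left; apply/eqP.
have -> : \sum_(i < 2 ^ k | (i < 2 ^ u)%N) chi R a (nu i) =
          \sum_(v | T v) chi R a v.
  rewrite (reindex (@nu k)) /=; last exact/onW_bij/nu_bij.
  by apply: eq_bigl => i; rewrite nu_lt_exp // ltnW.
apply: (@sum_chi_eq0 _ _ _ w).
  move=> v; apply: eq_forallb => j; case: (leqP u j) => //= uj.
  by rewrite mxE; have /forallP/(_ j) := Tw; rewrite uj => /eqP ->; rewrite addr0.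
by move: chiw; rewrite /chi; case: ifP; rewrite ?eqxx.
Qed.

(** For [a != 0] the character sums to 0 over all of [W], so its sum over the support of the code is
    minus its sum over the excluded subspace. *)
Lemma walsh_qcheck a : a != 0 ->
  walsh (@qcheck R k u) a = 0 \/ walsh (@qcheck R k u) a = - (2 ^+ u / D).
Proof.
move=> a0; set s := \sum_(i < 2 ^ k | (i < 2 ^ u)%N) chi R a (nu i).
suff -> : walsh (@qcheck R k u) a = - (s / D).
  have := sum_chi_nu_lt a; rewrite -/s !inE => /orP[]/eqP ->; last by right.
  by left; rewrite mul0r oppr0.
have sum0 := sum_chi_nu a0.
rewrite (bigID (fun i : 'I__ => (i < 2 ^ u)%N)) /= -/s in sum0.
rewrite /walsh (bigID (fun i : 'I__ => (i < 2 ^ u)%N)) /= big1 ?add0r.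
  rewrite -mulNr (_ : - s = \sum_(i < 2 ^ k | ~~ (i < 2 ^ u)%N) chi R a (nu i)).
    by rewrite mulr_suml; apply: eq_bigr => i /negPf iu; rewrite /qcheck iu mulrC.
  by apply/eqP; rewrite eq_sym -addr_eq0 addrC sum0.
by move=> i iu; rewrite /qcheck iu mul0r.
Qed.

Lemma dist_qcheck_half :
  dist (@qcheck R k u) (@qcheck R k k.-1) = Num.sqrt (H^-1 - D^-1).
Proof.
congr Num.sqrt.
rewrite (sum_sqr_sub_indicator _ (fun i : 'I__ => (i < 2 ^ k.-1)%N)).
(* The upper half of the indices lies in the support of [qcheck R u], so its mass is [H / D]. *)
have ukk : (u <= k.-1 <= k)%N by lia.
rewrite sum_qcheck_sqr (sum_qcheck_ge ukk) (sum_ge_exp2 (leq_pred k)).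
rewrite -/H kE (_ : 2 * H - H = H); last by ring.
by field; rewrite !gt_eqF.
Qed.

(** The mass of [q] off the hyperplane is [(1 - walsh q a) / 2], so the cross term is affine in
    [walsh q a]; its constant cancels against the squared norm of the hyperplane code. *)
Lemma sum_sqr_sub_qhyp q a : \sum_i q i = 1 -> a != 0 ->
  \sum_i (q i - qhyp R (perp a) i) ^+ 2 = \sum_i q i ^+ 2 + walsh q a / H.
Proof.
move=> q1 a0; rewrite (sum_sqr_sub_indicator _ (fun i => nu i \in perp a)).
have sumC (p : 'I_(2 ^ k) -> R) :
    \sum_(i | nu i \notin perp a) p i = \sum_i p i - zeta (perp a) p.
  apply/eqP; rewrite eq_sym subr_eq addrC.
  by rewrite [X in X == _](bigID (fun i => nu i \in perp a)).
have walsh1 : walsh (fun=> 1 : R) a = 0.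
  by rewrite /walsh; under eq_bigr do rewrite mul1r; rewrite sum_chi_nu.
rewrite !sumC !zeta_walsh q1 walsh1 sumr_const card_ord natrX -/H kE.
by field; rewrite gt_eqF.
Qed.

Lemma sum_sqr_sub_qbar q :
  (forall i : 'I_(2 ^ k), (i : nat) = 0%N -> q i = 0) -> \sum_i q i = 1 ->
  \sum_i (q i - qbar R i) ^+ 2 = \sum_i q i ^+ 2 - (2 ^+ k - 1)^-1.
Proof.
move=> q0 q1; have D1 : 2 ^+ k - 1 != 0 :> R.
  by rewrite gt_eqF // (lt_le_trans D_gt0) // lerB.
rewrite (sum_sqr_sub_indicator _ (fun i : 'I__ => (i : nat) == 0%N)).
have := sum_ge_exp2 (leq0n k); rewrite expn0 expr0.
under eq_bigl do rewrite ltnS leqn0.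
move=> ->; have -> : \sum_(i < 2 ^ k | (i : nat) != 0%N) q i = 1.
  rewrite -[RHS]q1 [RHS](bigID (fun i : 'I__ => (i : nat) == 0%N)) /=.
  by rewrite [X in _ = X + _]big1 ?add0r // => i /eqP/q0.
by field.
Qed.

Let radius_eq : D^-1 - (2 ^+ k - 1)^-1 = (2 ^+ u - 1) / (D * (2 ^+ k - 1)).
Proof.
have D1 : 2 ^+ k - 1 != 0 :> R.
  by rewrite gt_eqF // (lt_le_trans D_gt0) // lerB.
by rewrite /D; field; rewrite D1 gt_eqF.
Qed.

(** With total mass 1, the distance to [qbar] depends only on the second moment. *)
Lemma Cu_sum_sqr q : Cu u q -> \sum_i q i ^+ 2 = D^-1.
Proof.
case=> q0 _ q1 dq _; have D1 : 0 < 2 ^+ k - 1 :> R.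
  by rewrite (lt_le_trans D_gt0) // lerB.
(* Equal square roots give equal radicands only once both are known to be nonnegative. *)
have ge0 : 0 <= D^-1 - (2 ^+ k - 1)^-1.
  by rewrite radius_eq divr_ge0 ?subr_ge0 // mulr_ge0 // ltW.
move: dq; rewrite /dist -/D -radius_eq => /eqP; rewrite eqr_sqrt //.
  by rewrite sum_sqr_sub_qbar // => /eqP; lra.
by apply: sumr_ge0 => i _; exact: sqr_ge0.
Qed.

(** Squaring leaves [H^-1 - D^-1 <= D^-1 + walsh q a / H], and multiplying by [H] gives the
    threshold [1 - 2 * H / D], where [2 * H] is [2 ^+ k]. *)
Lemma qhyp_dist_walsh q a : \sum_i q i = 1 -> \sum_i q i ^+ 2 = D^-1 ->
  a != 0 -> (dist (@qcheck R k u) (@qcheck R k k.-1) <= dist q (qhyp R (perp a)))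
            = (- (2 ^+ u / D) <= walsh q a).
Proof.
move=> q1 q2 a0; rewrite dist_qcheck_half ler_sqrt; last first.
  by apply: sumr_ge0 => i _; exact: sqr_ge0.
rewrite sum_sqr_sub_qhyp // q2 -subr_ge0.
have -> : - (2 ^+ u / D) = 1 - 2 * H / D.
  by rewrite -kE /D; field; rewrite gt_eqF.
rewrite -[RHS]subr_ge0 -[RHS](pmulr_lge0 _ (_ : 0 < H^-1)) ?invr_gt0 //.
by congr (0 <= _); field; rewrite !gt_eqF.
Qed.

Lemma Cu_walsh_ge q a : Cu u q -> a != 0 -> - (2 ^+ u / D) <= walsh q a.
Proof.
move=> qC a0; have q2 := Cu_sum_sqr qC; case: qC => _ _ q1 _ qS.
rewrite -qhyp_dist_walsh //; apply: qS; rewrite Xi_perp; last first.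
  exact: leq_ltn_trans uk.
by apply: imset_f; rewrite inE.
Qed.

Lemma Cu_qcheck : Cu u (@qcheck R k u).
Proof.
have q0 (i : 'I_(2 ^ k)) : (i : nat) = 0%N -> qcheck R u i = 0.
  by move=> i0; rewrite /qcheck i0 expn_gt0.
split => //.
- by move=> i; rewrite /qcheck; case: ifP => _ //; rewrite invr_ge0 ltW.
- exact: sum_qcheck.
- rewrite /dist sum_sqr_sub_qbar ?sum_qcheck // sum_qcheck_sqr.
  by rewrite radius_eq.
- move=> S; rewrite Xi_perp ?(leq_ltn_trans _ uk) // => /imsetP[a].
  rewrite inE => a0 ->; rewrite qhyp_dist_walsh ?sum_qcheck ?sum_qcheck_sqr //.
  case: (walsh_qcheck a0) => -> //.
  by rewrite oppr_le0 divr_ge0 // ltW // exprn_gt0.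
Qed.

Lemma Cu_sum_walsh q : Cu u q -> \sum_(a | a != 0) walsh q a = -1.
Proof.
case=> q0 _ q1 _ _; have := sum_walsh q0.
by rewrite (bigD1 0) //= walsh0 q1; lra.
Qed.

Lemma Cu_sum_walsh_sqr q : Cu u q ->
  \sum_(a | a != 0) walsh q a ^+ 2 = 2 ^+ k / D - 1.
Proof.
move=> qC; have := sum_walsh_sqr q; rewrite (Cu_sum_sqr qC).
by case: qC => _ _ q1 _ _; rewrite (bigD1 0) //= walsh0 q1; lra.
Qed.

(* Both sides have the same first two Walsh moments, and the Walsh spectrum of
   [qcheck] sits exactly where the exponential meets its minorant parabola. *)
Lemma sum_expR_walsh_min (s : R) q : 0 < s -> Cu u q ->
  \sum_(a | a != 0) expR (s * walsh (@qcheck R k u) a) <=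
  \sum_(a | a != 0) expR (s * walsh q a).
Proof.
move=> s0 qC.
pose z0 := s * - (2 ^+ u / D).
have z0N : z0 < 0 by rewrite pmulr_rlt0 // oppr_lt0 divr_gt0 // exprn_gt0.
pose b := (expR z0 - 1 - z0) / z0 ^+ 2.
pose g (y : R) := 1 + s * y + b * (s * y) ^+ 2.
have sum_g (p : 'I_(2 ^ k) -> R) : Cu u p -> \sum_(a | a != 0) g (walsh p a) =
    \sum_(a : W k | a != 0) 1 + s * -1 + b * s ^+ 2 * (2 ^+ k / D - 1).
  move=> pC; rewrite -(Cu_sum_walsh_sqr pC) -(Cu_sum_walsh pC) !mulr_sumr.
  by rewrite -!big_split; apply: eq_bigr => a _ /=; rewrite /g; ring.
rewrite (eq_bigr (fun a => g (walsh (@qcheck R k u) a))) => [|a a0].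
  rewrite (sum_g _ Cu_qcheck) -(sum_g q qC); apply: ler_sum => a a0.
  by apply: expR_ge_parabola => //; rewrite ler_pM2l // Cu_walsh_ge.
rewrite /g; case: (walsh_qcheck a0) => ->; first by rewrite mulr0 expR0; ring.
by rewrite -/z0 /b; field; rewrite lt_eqF.
Qed.

End ExclusionCode.

(** * From [lambda] to exponential sums, and the conclusion *)

(** For total mass 1, [1 - zeta (perp a) q] is [(1 - walsh q a) / 2], so each power is an
    exponential affine in [walsh q a], whose constant part factors out. *)
Lemma lambda_walsh (R : realType) (k n : nat) (eps : R) (q : 'I_(2 ^ k) -> R) :
  (0 < k)%N -> 0 < eps < 1 -> \sum_i q i = 1 ->
  let s := - (n%:R / 2 * ln (eps / (2 - eps))) in
  lambda n eps q = (2 - eps) ^+ n * (2 ^+ k)^-1 *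
    (1 + expR (- s) * \sum_(a | a != 0) expR (s * walsh q a)) - 1.
Proof.
move=> k0 /andP[e0 e1] q1 s; have c0 : 0 < eps / (2 - eps) by rewrite divr_gt0 //; lra.
rewrite /lambda sum_Xi // mulr_sumr; congr (_ * (1 + _) - 1).
apply: eq_bigr => a _; rewrite -expRD /powR gt_eqF // zeta_walsh q1 /s.
by congr expR; field.
Qed.

Theorem theorem9 (R : realType) (k n u : nat) (eps : R) :
  (2 <= k)%N -> (1 <= n)%N -> (u <= k - 1)%N -> 0 < eps < 1 ->
  Cu u (@qcheck R k u) /\
  (forall q : 'I_(2 ^ k) -> R, Cu u q -> lambda n eps (@qcheck R k u) <= lambda n eps q).
Proof.
move=> k2 n1 uk1 e01; have uk : (u < k)%N by lia.
have k0 : (0 < k)%N by lia.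
split=> [|q qC]; first exact: Cu_qcheck.
have q1 : \sum_i q i = 1 by case: qC.
rewrite !(lambda_walsh _ k0 e01) ?sum_qcheck //.
have /andP[e0 e1] := e01.
rewrite lerD2r ler_pM2l; last by rewrite mulr_gt0 ?invr_gt0 ?exprn_gt0 //; lra.
rewrite lerD2l ler_pM2l ?expR_gt0 //; apply: sum_expR_walsh_min => //.
(* Since [eps < 1], the ratio [eps / (2 - eps)] is below 1 and its logarithm is negative; with [n]
   positive, [s] is positive. *)
rewrite oppr_gt0 pmulr_rlt0 ?divr_gt0 ?ltr0n // ln_lt0 //.
by rewrite divr_gt0 ?ltr_pdivrMr /=; lra.
Qed.
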